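(* Let $(G_n)$ be a sequence of connected regular graphs with vertex sets $V_n$ of size $n$, let $P_n$ be the transition matrix of the (simple) random walk on $G_n$, and consider a sequence of noisy voter models $\mathrm{NVM}(V_n,P_n,p_n)$ with $p_n\in(0,1]$ and $(p_n)$ non-increasing. If $p_n\gg n^{-1/2}$, i.e. $p_n n^{1/2}\to\infty$ as $n\to\infty$, then $W_n$ converges in distribution to $\mathcal N(0,1)$ as $n\to\infty$.
   Context: Noisy voter model: let $V$ be a finite set, $P$ an irreducible transition (stochastic) matrix on $V$ with stationary distribution $\pi$, and $p\in(0,1]$. $\mathrm{NVM}(V,P,p)$ is the discrete-time Markov chain on $\{0,1\}^V$ which at each step chooses a vertex $x\in V$ uniformly at random and updates only its opinion: with probability $p$ the opinion of $x$ is replaced by a fair coin flip in $\{0,1\}$; otherwise, with probability $1-p$, a vertex $y$ is chosen with probability $P(x,y)$ and the opinion of $x$ is replaced by the current opinion of $y$. For $p>0$ it has a unique stationary distribution $\Gamma$. With $\xi\sim\Gamma$, set $S=\sum_{x\in V}\pi(x)\xi(x)$, $\sigma^2=\mathrm{Var}(S)$ and $W=(S-\mathbb E(S))/\sigma$. A subscript $n$ (as in $W_n$) denotes these quantities for $\mathrm{NVM}(V_n,P_n,p_n)$. The random walk on a graph moves to a uniformly chosen neighbour at each step. *)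

(* Defs.v *)
From HB Require Import structures.
From mathcomp Require Export all_boot all_order all_algebra.
From mathcomp Require Export all_classical all_reals all_analysis.

Set Implicit Arguments.
Unset Strict Implicit.
Unset Printing Implicit Defensive.

Import Order.TTheory GRing.Theory Num.Theory.
Import numFieldNormedType.Exports.

Local Open Scope classical_set_scope.
Local Open Scope ring_scope.

Section Graph.
Context {V : finType}.
Implicit Types e : rel V.

Definition simple_graph e : Prop := symmetric e /\ irreflexive e.

Definition connected_graph e : Prop := forall x y : V, connect e x y.

Definition regular_graph e : Prop := exists d : nat, forall x : V, #|e x| = d.

(* If x is isolated, its row is zero; this cannot happen in a connected graph
   with at least two vertices. *)
Definition rw_matrix (R : realType) e (x y : V) : R :=
  (e x y)%:R / #|e x|%:R.

End Graph.

Definition stationary (R : realType) (T : finType) (P : T -> T -> R)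
    (mu : T -> R) : Prop :=
  [/\ forall x, 0 <= mu x,
      \sum_(x : T) mu x = 1
    & forall y, \sum_(x : T) mu x * P x y = mu y].

(* {0,1}^V, with the discrete sigma-algebra. *)
Definition config (V : finType) : Type := {ffun V -> bool}.

HB.instance Definition _ (V : finType) := Finite.on (config V).
HB.instance Definition _ (V : finType) :=
  isPointed.Build (config V) [ffun=> false].
HB.instance Definition _ (V : finType) :=
  @isMeasurable.Build default_measure_display (config V)
    discrete_measurable discrete_measurable0
    discrete_measurableC discrete_measurableU.

Section NVM.
Context {R : realType} {V : finType}.

Definition update (xi : config V) (x : V) (b : bool) : config V :=
  [ffun z => if z == x then b else xi z].

Definition nvm (P : V -> V -> R) (p : R) (xi eta : config V) : R :=
  \sum_(x : V) #|V|%:R^-1 *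
    (p * (\sum_(b : bool) 2^-1 * (eta == update xi x b)%:R)
     + (1 - p) * (\sum_(y : V) P x y * (eta == update xi x (xi y))%:R)).

Definition nvm_stationary (P : V -> V -> R) (p : R)
    (Gamma : probability (config V) R) : Prop :=
  stationary (nvm P p) (fun xi => fine (Gamma [set xi])).

Definition nvm_S (pi : V -> R) (xi : config V) : R :=
  \sum_(x : V) pi x * (xi x)%:R.

Definition nvm_sigma (pi : V -> R) (Gamma : probability (config V) R) : R :=
  Num.sqrt (fine 'V_Gamma[nvm_S pi]).

Definition nvm_W (pi : V -> R) (Gamma : probability (config V) R)
    (xi : config V) : R :=
  (nvm_S pi xi - fine 'E_Gamma[nvm_S pi]) / nvm_sigma pi Gamma.

Let measurable_nvm_W pi Gamma : measurable_fun setT (nvm_W pi Gamma).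
Proof. by []. Qed.

HB.instance Definition _ pi Gamma :=
  isMeasurableFun.Build _ _ _ _ (nvm_W pi Gamma) (measurable_nvm_W pi Gamma).

End NVM.

(* Pointwise convergence of the distribution functions at every continuity
   point of the limit; the X n may live on different probability spaces. *)
Definition cvg_in_distribution (R : realType) (d : nat -> measure_display)
    (T : forall n, measurableType (d n)) (Pr : forall n, probability (T n) R)
    (X : forall n, {RV (Pr n) >-> R})
    (nu : probability (measurableTypeR R) R) : Prop :=
  forall t : R,
    {for t, continuous (fun x : R => nu `]-oo, x]%classic)} ->
    cdf (X n) t @[n --> \oo] --> nu `]-oo, t]%classic.

(* Main.v *)
From HB Require Import structures.
Require Import Defs.
From mathcomp Require Import ring lra.
Import Order.TTheory GRing.Theory Num.Theory.
Import numFieldNormedType.Exports.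
Local Open Scope classical_set_scope.
Local Open Scope ring_scope.
Set Implicit Arguments.
Unset Strict Implicit.
Unset Printing Implicit Defensive.

(** Why the theorem holds.  On a connected regular graph the walk matrix P is
    doubly stochastic and pi is uniform, so W is the sum M of the spins
    2 xi(x) - 1, divided by its standard deviation s.  Writing xi' for the
    configuration one step after xi, double stochasticity makes M an exact
    eigenfunction of the dynamics: E[M(xi') | xi] = (1 - p/n) M(xi).  Stein's
    method for a stationary chain needs nothing more than this linear
    regression (equality in law of xi and xi' replaces reversibility):
    expanding E[G(W') - G(W)] = 0 to second order, with G' = f, gives
    [stein_regression], namely
      |E[f'(W) - W f(W)]| <= d (|f'|_oo + |f''|_oo),
    where d bounds twice the largest jump of W, which is at most 2/s, as well as
    the relative L1 fluctuation of V(xi) = E[(M(xi') - M(xi))^2 | xi].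

    The fluctuation of V is the heart of the matter.  By path coupling a step
    of the chain contracts the Lipschitz constants of functions of the
    configuration by 1 - p/n ([nvm_contraction]); hence an L-Lipschitz function
    f satisfies Var f <= L^2 P(move) n / p ([var_lipschitz]), where the factor
    P(move), the stationary probability that a step changes the configuration,
    is E[V]/4 because every actual jump of M is +-2.  Since V is
    (8/n)-Lipschitz, Var V <= 16 E[V] / (n p); and E[V] >= 2p because of the
    fair coins.  So the relative fluctuation of V has order 1/(p sqrt n), and
    so has 1/s, because s^2 = n E[V] / (2p) >= n.  This is
    [nvm_stein_discrepancy], with d = 4 / (p sqrt n), which tends to 0.

    It remains to pass from Stein's identity to distribution functions.  The
    smoothed thresholds x |-> Phi((a - x)/eps) are preserved by the
    Ornstein-Uhlenbeck semigroup up to a change of parameters, so that the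
    interpolation from W to a Gaussian is explicit: the derivative in r of
    Phi((a - r x) / sqrt(1 + eps^2 - r^2)) is F'(x) - x F(x) for a bounded
    smooth F = F_r ([is_derive_interpolation]), and no Stein equation has to be
    solved.  This yields [stein_smooth_comparison]; squeezing an indicator
    between smoothed thresholds and letting eps go to 0 gives
    [stein_cdf_cvg]. *)

(** * The standard Gaussian distribution *)

Section Gaussian.
Context {R : realType}.
Implicit Types t x y a r : R.

Definition gauss_pdf : R -> R := normal_pdf 0 1.
Definition gauss_cdf t : R := fine (normal_prob 0 1 `]-oo, t]).

Lemma gauss_pdfE y :
  gauss_pdf y = normal_peak 1 * expR (- (y ^+ 2 / 2)).
Proof.
rewrite /gauss_pdf normal_pdfE ?oner_eq0// /normal_fun subr0 expr1n.
by rewrite mulNr.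
Qed.

Lemma gauss_pdf_ge0 y : 0 <= gauss_pdf y.
Proof. exact: normal_pdf_ge0. Qed.

Lemma normal_peak1_le1 : normal_peak 1 <= 1 :> R.
Proof.
rewrite /normal_peak expr1n mul1r invf_le1.
- rewrite -[leLHS]sqrtr1 ler_wsqrtr//.
  by rewrite mulr2n; have := @pi_ge2 R; lra.
- by rewrite sqrtr_gt0 mulrn_wgt0// pi_gt0.
Qed.

(** From exp u >= 1 + u; a polynomial decay of order two is all that is needed
    to bound the first two derivatives of the density. *)
Lemma gauss_pdf_decay y : (1 + y ^+ 2 / 2) * gauss_pdf y <= 1.
Proof.
rewrite gauss_pdfE expRN mulrCA.
have e0 := expR_gt0 (y ^+ 2 / 2).
rewrite (le_trans _ normal_peak1_le1)// ler_piMr ?normal_peak_ge0//.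
by rewrite ler_pdivrMr// mul1r expR_ge1Dx.
Qed.

Lemma gauss_pdf_bound1 y : `|y * gauss_pdf y| <= 1.
Proof.
apply: le_trans (gauss_pdf_decay y).
rewrite normrM (ger0_norm (gauss_pdf_ge0 y)) ler_wpM2r ?gauss_pdf_ge0//.
by rewrite ler_norml; apply/andP; split; nra.
Qed.

Lemma gauss_pdf_bound2 y : `|(1 - y ^+ 2) * gauss_pdf y| <= 2.
Proof.
apply: (@le_trans _ _ (2 * ((1 + y ^+ 2 / 2) * gauss_pdf y))); last first.
  by have := gauss_pdf_decay y; lra.
rewrite normrM (ger0_norm (gauss_pdf_ge0 y)) mulrA.
rewrite ler_wpM2r ?gauss_pdf_ge0// ler_norml.
by have := sqr_ge0 y; lra.
Qed.

Global Instance is_derive_gauss_pdf y :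
  is_derive y 1 gauss_pdf (- (y * gauss_pdf y)).
Proof.
have -> : gauss_pdf =
    (fun z => normal_peak 1 *: expR (- (2^-1 *: (z ^+ 2)))).
  by apply/funext => z; rewrite gauss_pdfE /GRing.scale/= [_ / 2]mulrC.
apply: is_derive_eq; rewrite /GRing.scale/= !mulr1.
by field.
Qed.

Lemma continuous_gauss_pdf : continuous gauss_pdf.
Proof. by apply: continuous_normal_pdf; rewrite oner_eq0. Qed.

Global Instance is_derive_gauss_cdf t :
  is_derive t 1 gauss_cdf (gauss_pdf t).
Proof.
have gi : lebesgue_measure.-integrable `]-oo, (t + 1)] (EFin \o gauss_pdf).
  apply: integrableS (@integrable_normal_pdf R 0 1) => //.
have tt : t < t + 1 by rewrite ltrDl.
have [||D1 D2] := @continuous_FTC1 R gauss_pdf -oo%O t (t + 1) tt gi.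
- by rewrite ltNyr.
- exact: continuous_gauss_pdf.
by apply: DeriveDef; [exact: D1|rewrite -derive1E D2].
Qed.

Lemma gauss_cdf_ndecr : {homo gauss_cdf : x y / x <= y}.
Proof.
move=> x y xy; rewrite fine_le ?fin_num_measure// le_measure ?inE//.
exact: subset_itvl.
Qed.

Lemma gauss_cdf_ge0 t : 0 <= gauss_cdf t.
Proof. exact: fine_ge0. Qed.

Lemma gauss_cdf_le1 t : gauss_cdf t <= 1.
Proof.
by rewrite -lee_fin fineK ?fin_num_measure// probability_le1.
Qed.

Lemma continuous_gauss_cdf : continuous gauss_cdf.
Proof. by move=> t; apply/differentiable_continuous/derivable1_diffP. Qed.

Let idR : measurableTypeR R -> R := idfun.
#[local] HB.instance Definition _ :=
  @isMeasurableFun.Build _ _ _ _ idR (@measurable_id _ _ setT).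

Lemma cvg_gauss_cdfy : gauss_cdf x @[x --> +oo] --> (1 : R).
Proof.
exact/fine_cvg/(@cvg_cdfy1 _ _ _ _ (idR : {RV normal_prob 0 1 >-> R})).
Qed.

Lemma cvg_gauss_cdfNy : gauss_cdf x @[x --> -oo] --> (0 : R).
Proof.
exact/fine_cvg/(@cvg_cdfNy0 _ _ _ _ (idR : {RV normal_prob 0 1 >-> R})).
Qed.

End Gaussian.

(** * Smoothed thresholds and Gaussian interpolation *)

Section Interpolation.
Context {R : realType}.
Implicit Types a r x tau eps : R.

Lemma is_derive_seq_sum (I : Type) (s : seq I) (h : I -> R -> R)
    (dh : I -> R) x :
  (forall i, is_derive x 1 (h i) (dh i)) ->
  is_derive x 1 (fun z => \sum_(i <- s) h i z) (\sum_(i <- s) dh i).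
Proof.
move=> hd; elim: s => [|i s IHs].
  rewrite big_nil (_ : (fun _ => _) = cst 0); first exact: is_derive_cst.
  by apply/funext => z; rewrite big_nil.
rewrite big_cons (_ : (fun _ => _) = h i + (fun z => \sum_(j <- s) h j z)).
  exact: is_deriveD.
by apply/funext => z; rewrite big_cons.
Qed.

(** The test functions to which the interpolation applies Stein's operator,
    and their first two derivatives in x. *)
Definition bump a r tau x := gauss_pdf ((a - r * x) / tau) / tau.

Definition bump1 a r tau x :=
  r / tau ^+ 2 * ((a - r * x) / tau * gauss_pdf ((a - r * x) / tau)).

Definition bump2 a r tau x := - (r ^+ 2 / tau ^+ 3) *
  ((1 - ((a - r * x) / tau) ^+ 2) * gauss_pdf ((a - r * x) / tau)).

Let is_derive_arg a r tau x : tau != 0 ->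
  is_derive x 1 (fun z => (a - r * z) / tau) (- r / tau).
Proof.
move=> tau0.
rewrite (_ : (fun z => _) = (fun z => tau^-1 *: (cst a z - r *: z))).
  apply: is_derive_eq; rewrite /GRing.scale/= mulr1 sub0r; exact: mulrC.
by apply/funext => z; rewrite mulrC.
Qed.

Lemma is_derive_gauss_cdf_slope a r tau x : tau != 0 -> r != 0 ->
  is_derive x 1 (fun z => - r^-1 * gauss_cdf ((a - r * z) / tau))
    (bump a r tau x).
Proof.
move=> tau0 r0; have D := is_derive_arg a r x tau0.
have D1 := @is_derive1_comp _ _ _ x _ _ (is_derive_gauss_cdf _) D.
have D2 := is_deriveZ (- r^-1) D1.
apply: is_derive_eq.
rewrite /bump /GRing.scale/=.
by field; rewrite tau0.
Qed.

Lemma is_derive_bump a r tau x : tau != 0 ->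
  is_derive x 1 (bump a r tau) (bump1 a r tau x).
Proof.
move=> tau0; have D := is_derive_arg a r x tau0.
have D1 := @is_derive1_comp _ _ _ x _ _ (is_derive_gauss_pdf _) D.
have D2 := is_deriveZ tau^-1 D1.
rewrite (_ : bump a r tau =
  tau^-1 *: (gauss_pdf \o (fun z => (a - r * z) / tau))).
  apply: is_derive_eq.
  by rewrite /bump1 /GRing.scale/=; field.
by apply/funext => z; rewrite /bump mulrC.
Qed.

Lemma is_derive_bump1 a r tau x : tau != 0 ->
  is_derive x 1 (bump1 a r tau) (bump2 a r tau x).
Proof.
move=> tau0; have D := is_derive_arg a r x tau0.
have D1 := @is_derive1_comp _ _ _ x _ _ (is_derive_gauss_pdf _) D.
have D2 := is_deriveZ (r / tau ^+ 2) (is_deriveM D D1).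
rewrite (_ : bump1 a r tau =
  (r / tau ^+ 2) *: ((fun z => (a - r * z) / tau) *
                     (gauss_pdf \o (fun z => (a - r * z) / tau)))).
  apply: is_derive_eq.
  by rewrite /bump2 /GRing.scale/=; field.
by apply/funext => z.
Qed.

(** If Z is a standard Gaussian independent of the noise that smooths the
    threshold at scale eps, then r x + sqrt(1 - r^2) Z has smoothing scale
    sqrt(eps^2 + 1 - r^2) around r x. *)
Definition width eps r := Num.sqrt (1 + eps ^+ 2 - r ^+ 2).

Lemma width_ge eps r : 0 < eps -> 0 <= r <= 1 -> eps <= width eps r.
Proof.
move=> eps0 /andP[r0 r1]; rewrite -[leLHS](ger0_norm (ltW eps0)) -sqrtr_sqr.
by apply: ler_wsqrtr; nra.
Qed.

Lemma width_gt0 eps r : 0 < eps -> 0 <= r <= 1 -> 0 < width eps r.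
Proof. by move=> eps0 r01; exact: lt_le_trans (width_ge eps0 r01). Qed.

(* The width stays above eps, so that the bounds below are uniform in r. *)
Let ratio_bound eps r j k : 0 < eps -> 0 <= r <= 1 ->
  `|r ^+ j / width eps r ^+ k| <= eps ^- k.
Proof.
move=> eps0 r01; have w0 := width_gt0 eps0 r01.
have /andP[r0 r1] := r01.
have wk : 0 < width eps r ^+ k by rewrite exprn_gt0.
rewrite ger0_norm; last by rewrite divr_ge0 ?exprn_ge0// ltW.
rewrite ler_pdivrMr// mulrC (le_trans (exprn_ile1 _ r0 r1))//.
rewrite ler_pdivlMr ?exprn_gt0// mul1r lerXn2r ?nnegrE ?width_ge// ltW//.
Qed.

Lemma bump1_bound a r eps x : 0 < eps -> 0 <= r <= 1 ->
  `|bump1 a r (width eps r) x| <= eps ^- 2.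
Proof.
move=> eps0 r01; rewrite /bump1 normrM -[leRHS]mulr1.
by rewrite ler_pM ?gauss_pdf_bound1// (ratio_bound 1).
Qed.

Lemma bump2_bound a r eps x : 0 < eps -> 0 <= r <= 1 ->
  `|bump2 a r (width eps r) x| <= 2 * eps ^- 3.
Proof.
move=> eps0 r01; rewrite /bump2 normrM normrN mulrC.
by rewrite ler_pM ?gauss_pdf_bound2// ratio_bound.
Qed.

(** The Ornstein-Uhlenbeck equation along r = exp (- time): moving r by dr
    changes the smoothed threshold by the generator x |-> g'' - x g' applied to
    it, that is by Stein's operator applied to [bump]. *)
Lemma is_derive_interpolation a eps r x : 0 < eps -> 0 <= r <= 1 ->
  is_derive r 1 (fun s => gauss_cdf ((a - s * x) / width eps s))
    (bump1 a r (width eps r) x - x * bump a r (width eps r) x).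
Proof.
move=> eps0 r01; have w0 := width_gt0 eps0 r01.
have wE : width eps r ^+ 2 = 1 + eps ^+ 2 - r ^+ 2.
  by rewrite sqr_sqrtr// ltW// -sqrtr_gt0.
have s0 : 0 < 1 + eps ^+ 2 - r ^+ 2 by rewrite -sqrtr_gt0.
have Dq : is_derive r 1 (fun s => 1 + eps ^+ 2 - s ^+ 2) (- (2 * r)).
  rewrite (_ : (fun s => _) = (fun s => cst (1 + eps ^+ 2) s - s ^+ 2)) //.
  apply: is_derive_eq; rewrite /GRing.scale/=; ring.
have Dw : is_derive r 1 (width eps) (- r / width eps r).
  have Ds := @is_derive1_comp _ _ _ r _ _ (is_derive1_sqrt s0) Dq.
  apply: is_derive_eq; rewrite -/(width eps r); field.
  by rewrite gt_eqF.
have Dl : is_derive r 1 (fun s => a - s * x) (- x).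
  rewrite (_ : (fun s => _) = (fun s => cst a s - x *: s)).
    apply: is_derive_eq; rewrite /GRing.scale/=; ring.
  by apply/funext => s; rewrite /GRing.scale/= mulrC.
have wn0 : width eps r != 0 by rewrite gt_eqF.
have Dv := is_deriveV wn0 Dw.
have Dy := is_deriveM Dl Dv.
have D := @is_derive1_comp _ _ _ r _ _ (is_derive_gauss_cdf _) Dy.
apply: is_derive_eq.
rewrite /bump1 /bump /GRing.scale/= -![(_ * _ : R -> R) r]/(_ * _).
by field.
Qed.

End Interpolation.

(** * From Stein's identity to distribution functions *)

Section SteinMethod.
Context {R : realType}.

(** The test function f comes with an antiderivative G: for a stationary chain
    it is G that gets expanded along a step. *)
Definition stein_discrepancy (T : finType) (mu W : T -> R) (d : R) : Prop :=
  forall (G f f' f'' : R -> R) (B1 B2 : R),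
    (forall x : R, is_derive x 1 G (f x)) ->
    (forall x : R, is_derive x 1 f (f' x)) ->
    (forall x : R, is_derive x 1 f' (f'' x)) ->
    (forall x, `|f' x| <= B1) -> (forall x, `|f'' x| <= B2) ->
    `|\sum_i mu i * (f' (W i) - W i * f (W i))| <= d * (B1 + B2).

(** The interpolation runs from r = 0, where the smoothed threshold is constant
    in x, to r = 1; by the mean value theorem the total change is the
    expectation of Stein's operator at one intermediate r. *)
Lemma stein_smooth_comparison (T : finType) (mu W : T -> R) (d a eps : R) :
  0 < eps -> \sum_i mu i = 1 -> stein_discrepancy mu W d ->
  `|\sum_i mu i * gauss_cdf ((a - W i) / eps)
    - gauss_cdf (a / Num.sqrt (1 + eps ^+ 2))|
  <= d * (eps ^- 2 + 2 * eps ^- 3).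
Proof.
move=> eps0 mu1 stein.
pose g (r : R) : R := \sum_i mu i * gauss_cdf ((a - r * W i) / width eps r).
pose dg (r : R) : R := \sum_i mu i *
  (bump1 a r (width eps r) (W i) - W i * bump a r (width eps r) (W i)).
have Dg (r : R) : 0 <= r <= 1 -> is_derive r 1 g (dg r).
  move=> r01; apply: is_derive_seq_sum => i.
  have Di := is_derive_interpolation a (W i) eps0 r01.
  exact: (is_deriveZ (mu i) Di).
have [||r] := @MVT R g dg 0 1 ltr01.
- by move=> r; rewrite in_itv/= => /andP[r0 r1]; apply: Dg; rewrite !ltW.
- by apply: derivable_within_continuous => r; rewrite in_itv/= => /Dg[].
rewrite in_itv/= => /andP[r0 r1]; rewrite subr0 mulr1.
have r01 : 0 <= r <= 1 by rewrite !ltW.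
have w0 : width eps r != 0 by rewrite gt_eqF// width_gt0.
have -> : g 1 = \sum_i mu i * gauss_cdf ((a - W i) / eps).
  apply: eq_bigr => i _; rewrite /width mul1r expr1n addrAC subrr add0r.
  by rewrite sqrtr_sqr gtr0_norm.
have -> : g 0 = gauss_cdf (a / Num.sqrt (1 + eps ^+ 2)).
  rewrite /g -[RHS]mul1r -[X in X * _]mu1 mulr_suml; apply: eq_bigr => i _.
  by rewrite /width mul0r expr0n/= !subr0.
pose w := width eps r.
move=> ->; apply: (stein (fun z => - r^-1 * gauss_cdf ((a - r * z) / w))
  (bump a r w) (bump1 a r w) (bump2 a r w)) => x.
- by apply: is_derive_gauss_cdf_slope; rewrite // gt_eqF.
- exact: is_derive_bump.
- exact: is_derive_bump1.
- exact: bump1_bound.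
- exact: bump2_bound.
Qed.

(** A threshold smoothed at scale h^2 and shifted by h dominates the indicator
    up to the Gaussian tail beyond h / h^2 = 1/h, which vanishes as h -> 0. *)
Lemma indicator_le_gauss_cdf (t h w : R) : 0 < h ->
  (w <= t)%R%:R <= gauss_cdf ((t + h - w) / h ^+ 2) + (1 - gauss_cdf h^-1).
Proof.
move=> h0; have [wt|tw] := leP w t; last first.
  by rewrite addr_ge0 ?gauss_cdf_ge0// subr_ge0 gauss_cdf_le1.
rewrite addrCA lerDl subr_ge0; apply: gauss_cdf_ndecr.
rewrite ler_pdivlMr ?exprn_gt0// expr2 mulrA mulVf ?gt_eqF// mul1r; lra.
Qed.

Lemma indicator_ge_gauss_cdf (t h w : R) : 0 < h ->
  gauss_cdf ((t - h - w) / h ^+ 2) - gauss_cdf (- h^-1) <= (w <= t)%R%:R.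
Proof.
move=> h0; have [wt|tw] := leP w t.
  by rewrite lerBlDr (le_trans (gauss_cdf_le1 _))// lerDl gauss_cdf_ge0.
rewrite subr_le0; apply: gauss_cdf_ndecr.
rewrite ler_pdivrMr ?exprn_gt0// mulNr expr2 mulrA mulVf ?gt_eqF// mul1r; lra.
Qed.

Lemma cvg_smoothed_threshold (t s : R) :
  gauss_cdf ((t + s * h) / Num.sqrt (1 + (h ^+ 2) ^+ 2)) @[h --> 0^'+]
    --> gauss_cdf t.
Proof.
apply: continuous_cvg; first exact: continuous_gauss_cdf.
apply: cvg_at_right_filter.
have hid : h @[h --> (0 : R)] --> (0 : R) by exact: cvg_id.
rewrite -[X in _ --> X]divr1 -[X in X / _]addr0 -[X in _ + X](mulr0 s).
apply: cvgM; first by apply: cvgD; [exact: cvg_cst|exact: cvgMl_tmp].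
apply: cvgV; first exact: oner_neq0.
rewrite -[X in _ --> X]sqrtr1; apply: continuous_cvg.
  exact: sqrt_continuous.
rewrite -[X in _ --> X]addr0; apply: cvgD; first exact: cvg_cst.
rewrite -[X in _ --> X](_ : 0 ^+ 4 = 0); last by rewrite expr0n.
by under eq_fun do rewrite -exprM; exact: exprn_continuous.
Qed.

Lemma cvg_inv_at_right0 : h^-1 @[h --> (0 : R)^'+] --> +oo.
Proof.
apply/cvgrVy; first exact: nbhs_right_gt.
by apply: cvg_at_right_filter; exact: cvg_id.
Qed.

Lemma cvg_upper_envelope (t : R) :
  gauss_cdf ((t + h) / Num.sqrt (1 + (h ^+ 2) ^+ 2)) + (1 - gauss_cdf h^-1)
    @[h --> 0^'+] --> gauss_cdf t.
Proof.
rewrite -[X in _ --> X]addr0 -[X in _ + X](subrr 1); apply: cvgD.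
  by have := @cvg_smoothed_threshold t 1; under eq_fun do rewrite mul1r.
apply: cvgB; first exact: cvg_cst.
exact: cvg_comp cvg_inv_at_right0 cvg_gauss_cdfy.
Qed.

Lemma cvg_lower_envelope (t : R) :
  gauss_cdf ((t - h) / Num.sqrt (1 + (h ^+ 2) ^+ 2)) - gauss_cdf (- h^-1)
    @[h --> 0^'+] --> gauss_cdf t.
Proof.
rewrite -[X in _ --> X]subr0; apply: cvgB.
  by have := @cvg_smoothed_threshold t (-1); under eq_fun do rewrite mulN1r.
apply: (cvg_comp _ _ _ cvg_gauss_cdfNy).
exact/cvgNrNy/cvg_inv_at_right0.
Qed.

(** The smoothing scale is fixed first, so as to bring both envelopes close to
    Phi(t); at a fixed scale the comparison with the Gaussian has an error
    proportional to d n. *)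
Lemma stein_cdf_cvg (T : nat -> finType) (mu W : forall n, T n -> R)
    (d : R^nat) (t : R) :
  (\forall n \near \oo, [/\ forall i, 0 <= mu n i, \sum_i mu n i = 1
     & stein_discrepancy (mu n) (W n) (d n)]) ->
  d n @[n --> \oo] --> 0 ->
  \sum_i mu n i * (W n i <= t)%R%:R @[n --> \oo] --> gauss_cdf t.
Proof.
move=> stein d0; apply/cvgrPdist_le => e e0.
have e2 : 0 < e / 2 by rewrite divr_gt0.
have [h [h0 up lo]] : exists h : R, [/\ 0 < h,
    `|gauss_cdf t - (gauss_cdf ((t + h) / Num.sqrt (1 + (h ^+ 2) ^+ 2))
       + (1 - gauss_cdf h^-1))| <= e / 2
  & `|gauss_cdf t - (gauss_cdf ((t - h) / Num.sqrt (1 + (h ^+ 2) ^+ 2))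
       - gauss_cdf (- h^-1))| <= e / 2].
  near (0 : R)^'+ => h; exists h; split; near: h.
  - exact: nbhs_right_gt.
  - by move/cvgrPdist_le : (@cvg_upper_envelope t); apply.
  - by move/cvgrPdist_le : (@cvg_lower_envelope t); apply.
pose C := (h ^+ 2) ^- 2 + 2 * (h ^+ 2) ^- 3.
have h2 : 0 < h ^+ 2 by rewrite exprn_gt0.
have dC : d n * C @[n --> \oo] --> 0 by rewrite -(mul0r C); exact: cvgMr_tmp.
near=> n.
have [mu0 mu1 sn] : [/\ forall i, 0 <= mu n i, \sum_i mu n i = 1
     & stein_discrepancy (mu n) (W n) (d n)] by near: n.
have dn : d n * C <= e / 2.
  apply: le_trans (ler_norm _) _; rewrite -normrN -sub0r; near: n.
  by move/cvgrPdist_le : dC; apply.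
have Sup := stein_smooth_comparison (t + h) h2 mu1 sn.
have Slo := stein_smooth_comparison (t - h) h2 mu1 sn.
have avg c : \sum_i mu n i * c = c by rewrite -mulr_suml mu1 mul1r.
have Fup : \sum_i mu n i * (W n i <= t)%R%:R <=
    \sum_i mu n i * gauss_cdf ((t + h - W n i) / h ^+ 2)
    + (1 - gauss_cdf h^-1).
  rewrite -[X in _ + X]avg -big_split/=; apply: ler_sum => i _.
  by rewrite -mulrDr ler_wpM2l// indicator_le_gauss_cdf.
have Flo : \sum_i mu n i * gauss_cdf ((t - h - W n i) / h ^+ 2)
    - gauss_cdf (- h^-1) <= \sum_i mu n i * (W n i <= t)%R%:R.
  rewrite -[X in _ - X]avg -sumrB; apply: ler_sum => i _.
  by rewrite -mulrBr ler_wpM2l// indicator_ge_gauss_cdf.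
move: up lo Sup Slo; rewrite -/C !ler_distl => /andP[up _] /andP[_ lo].
move=> /andP[_ Sup] /andP[Slo _].
by apply/andP; split; lra.
Unshelve. all: by end_near. Qed.

End SteinMethod.

(** * Second order expansion *)

Section Taylor.
Context {R : realType}.
Implicit Types x y z : R.

Lemma derive_bound (g dg : R -> R) (B : R) x y :
  (forall z : R, is_derive z 1 g (dg z)) ->
  (forall z, `|z - x| <= `|y - x| -> `|dg z| <= B) ->
  `|g y - g x| <= B * `|y - x|.
Proof.
move=> Dg dgB.
have gc (a b : R) : {within `[a, b], continuous g}.
  by apply: derivable_within_continuous => z _; case: (Dg z).
have [xy|yx] := leP x y.
  have [c] := MVT_segment xy (fun z _ => Dg z) (gc x y).
  rewrite in_itv/= => /andP[xc cy] ->; rewrite normrM ler_wpM2r// dgB//.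
  by rewrite !ger0_norm ?subr_ge0// lerB.
have [c] := MVT_segment (ltW yx) (fun z _ => Dg z) (gc y x).
rewrite in_itv/= => /andP[yc cx]; rewrite distrC => ->.
rewrite normrM [X in _ * X]distrC ler_wpM2r// dgB//.
rewrite distrC [leRHS]distrC !ger0_norm ?subr_ge0 ?(ltW yx)// lerB//.
Qed.

(** Three successive uses of the mean value inequality; the constant 1 instead
    of the sharp 1/6 is harmless. *)
Lemma taylor3_bound (G f f' f'' : R -> R) (B : R) x y :
  (forall z : R, is_derive z 1 G (f z)) ->
  (forall z : R, is_derive z 1 f (f' z)) ->
  (forall z : R, is_derive z 1 f' (f'' z)) ->
  (forall z, `|f'' z| <= B) ->
  `|G y - G x - (f x * (y - x) + f' x * (y - x) ^+ 2 / 2)|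
  <= B * `|y - x| ^+ 3.
Proof.
move=> DG Df Df' f''B.
have B0 : 0 <= B by exact: le_trans (f''B 0).
have id_shift (z : R) : is_derive z 1 (fun s => s - x) 1.
  rewrite (_ : (fun s => _) = (fun s => s - cst x s)) //.
  by apply: is_derive_eq; rewrite subr0.
have d1 z : `|z - x| <= `|y - x| -> `|f' z - f' x| <= B * `|y - x|.
  move=> zy; apply: le_trans (derive_bound Df' (fun s _ => f''B s)) _.
  by rewrite ler_wpM2l.
pose g z := f z - (f x + f' x * (z - x)).
have Dg (z : R) : is_derive z 1 g (f' z - f' x).
  have D := is_deriveZ (f' x) (id_shift z).
  rewrite (_ : g = (fun s => f s - (cst (f x) s + f' x *: (s - x)))) //.
  by apply: is_derive_eq; rewrite add0r /GRing.scale/= mulr1.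
have gx : g x = 0 by rewrite /g; ring.
have d2 z : `|z - x| <= `|y - x| -> `|g z| <= B * `|y - x| ^+ 2.
  move=> zy; rewrite -[g z]subr0 -gx.
  apply: le_trans (derive_bound Dg _) _.
    by move=> s sz; apply: d1; exact: le_trans zy.
  by rewrite expr2 mulrA ler_wpM2l// mulr_ge0.
pose h z := G z - (f x * (z - x) + f' x / 2 * (z - x) ^+ 2).
have Dh (z : R) : is_derive z 1 h (g z).
  have D := id_shift z.
  rewrite (_ : h =
    (fun s => G s - (f x *: (s - x) + (f' x / 2) *: (s - x) ^+ 2))) //.
  apply: is_derive_eq; rewrite /GRing.scale/= /g -mulr_natr/=.
  by field.
have hx : h x = G x by rewrite /h; ring.
have -> : G y - G x - (f x * (y - x) + f' x * (y - x) ^+ 2 / 2) = h y - h x.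
  by rewrite hx /h; ring.
by apply: le_trans (derive_bound Dh d2) _; rewrite -mulrA -exprSr.
Qed.

End Taylor.

(** * Stationary finite Markov chains *)

Section FiniteMean.
Context {R : realType} {T : finType}.
Variable mu : T -> R.
Implicit Types f g : T -> R.

Definition mean f := \sum_s mu s * f s.
Definition var f := mean (fun s => (f s - mean f) ^+ 2).

Lemma eq_mean f g : f =1 g -> mean f = mean g.
Proof. by move=> fg; apply: eq_bigr => s _; rewrite fg. Qed.

Lemma meanD f g : mean (fun s => f s + g s) = mean f + mean g.
Proof.
by rewrite /mean -big_split/=; apply: eq_bigr => s _; rewrite mulrDr.
Qed.

Lemma meanZ (c : R) f : mean (fun s => c * f s) = c * mean f.
Proof. by rewrite /mean mulr_sumr; apply: eq_bigr => s _; rewrite mulrCA. Qed.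

Lemma meanB f g : mean (fun s => f s - g s) = mean f - mean g.
Proof. by rewrite /mean -sumrB; apply: eq_bigr => s _; rewrite mulrBr. Qed.

Hypothesis mu_ge0 : forall s, 0 <= mu s.
Hypothesis mu_sum1 : \sum_s mu s = 1.

Lemma mean_cst (c : R) : mean (fun=> c) = c.
Proof. by rewrite /mean -mulr_suml mu_sum1 mul1r. Qed.

Lemma ler_mean f g : (forall s, f s <= g s) -> mean f <= mean g.
Proof. by move=> fg; apply: ler_sum => s _; rewrite ler_wpM2l. Qed.

Lemma ler_norm_mean f : `|mean f| <= mean (fun s => `|f s|).
Proof.
apply: le_trans (ler_norm_sum _ _ _) _; apply: ler_sum => s _.
by rewrite normrM ger0_norm.
Qed.

(** A substitute for Cauchy-Schwarz: the arithmetic-geometric mean inequality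
    with a free scale c, to be taken of the order of the standard deviation. *)
Lemma mean_norm_le_var f (c : R) : 0 < c ->
  mean (fun s => `|f s - mean f|) <= (var f / c + c) / 2.
Proof.
move=> c0; rewrite -[c in _ + c]mean_cst [var f / c]mulrC -meanZ -meanD mulrC.
rewrite -meanZ; apply: ler_mean => s.
rewrite -[X in c^-1 * X]real_normK ?num_real//.
set u := `|_|; rewrite -subr_ge0.
have -> : 2^-1 * (c^-1 * u ^+ 2 + c) - u = (u - c) ^+ 2 / (2 * c).
  by field; rewrite gt_eqF.
by rewrite divr_ge0 ?sqr_ge0// mulr_ge0// ltW.
Qed.

End FiniteMean.

Section FiniteChain.
Context {R : realType} {T : finType}.
Variables (K : T -> T -> R) (mu : T -> R).
Local Notation mean := (mean mu).
Local Notation var := (var mu).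
Hypothesis K_ge0 : forall s t, 0 <= K s t.
Hypothesis K_sum1 : forall s, \sum_t K s t = 1.
Hypothesis mu_stationary : stationary K mu.
Implicit Types f g W : T -> R.

Definition step f s := \sum_t K s t * f t.

Let mu_ge0 s : 0 <= mu s. Proof. by case: mu_stationary. Qed.
Let mu_sum1 : \sum_s mu s = 1. Proof. by case: mu_stationary. Qed.

Let ler_mean := @ler_mean _ _ _ mu_ge0.
Let ler_norm_mean := @ler_norm_mean _ _ _ mu_ge0.
Let mean_cst := @mean_cst _ _ _ mu_sum1.

Lemma mean_step f : mean (step f) = mean f.
Proof.
case: mu_stationary => _ _ muK; rewrite /mean /step.
under eq_bigr do rewrite mulr_sumr.
rewrite exchange_big/=; apply: eq_bigr => t _.
by rewrite -(muK t) mulr_suml; apply: eq_bigr => s _; rewrite mulrA.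
Qed.

Definition increment2 f s := \sum_t K s t * (f t - f s) ^+ 2.

Lemma step_sqr_dev f (c : R) s :
  step (fun t => (f t - c) ^+ 2) s =
  (step f s - c) ^+ 2 + \sum_t K s t * (f t - step f s) ^+ 2.
Proof.
have sumB : \sum_t K s t * (f t - step f s) = 0.
  under eq_bigr do rewrite mulrBr.
  by rewrite sumrB -mulr_suml K_sum1 mul1r subrr.
move: sumB; set m := step f s => sumB; rewrite /step.
have -> : (m - c) ^+ 2 = \sum_t K s t * (m - c) ^+ 2.
  by rewrite -mulr_suml K_sum1 mul1r.
have cross : \sum_t 2 * (m - c) * (K s t * (f t - m)) = 0.
  by rewrite -mulr_sumr sumB mulr0.
rewrite -[RHS]addr0 -[X in _ + X]cross -!big_split/=.
by apply: eq_bigr => t _; ring.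
Qed.

(** The law of total variance along a step of the stationary chain, with the
    conditional variance bounded by the mean square displacement. *)
Lemma var_step_decomposition f : var f <= mean (increment2 f) + var (step f).
Proof.
rewrite /var mean_step addrC -meanD -mean_step; apply: ler_mean => s.
rewrite step_sqr_dev lerD2l.
rewrite -[increment2 f s]/(step (fun t => (f t - f s) ^+ 2) s) step_sqr_dev.
by rewrite lerDr sqr_ge0.
Qed.

Section Contraction.
Variables (adj : rel T) (a D : R).
Hypothesis a_ge0 : 0 <= a.
Hypothesis a_lt1 : a < 1.
Hypothesis K_adj : forall s t, K s t != 0 -> adj s t.

Definition lipschitz (L : R) f := forall s t, adj s t -> `|f t - f s| <= L.

Hypothesis contraction :
  forall L f, lipschitz L f -> lipschitz (a * L) (step f).
Hypothesis diameter :
  forall L f, lipschitz L f -> forall s t, `|f t - f s| <= D * L.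

Definition move_prob s := \sum_(t | t != s) K s t.

Lemma increment2_le_move L f s : lipschitz L f ->
  increment2 f s <= L ^+ 2 * move_prob s.
Proof.
move=> Lf; rewrite /increment2 (bigD1 s)//= subrr expr0n mulr0 add0r.
rewrite mulr_sumr; apply: ler_sum => t ts; rewrite [leRHS]mulrC.
have [->|/K_adj/Lf ftL] := eqVneq (K s t) 0; first by rewrite !mul0r.
rewrite ler_wpM2l// -[leLHS]real_normK ?num_real// lerXn2r ?nnegrE//.
exact: le_trans ftL.
Qed.

(** Unrolling [var_step_decomposition] k times: after j steps the Lipschitz
    constant is a^j L, so the displacement terms form a geometric series (its
    ratio a^2 is replaced by a), and what remains is the variance of a function
    that is almost constant. *)
Lemma var_lipschitz_iter L f k : lipschitz L f ->
  var f <= L ^+ 2 * (mean move_prob / (1 - a) + D ^+ 2 * a ^+ (2 * k)).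
Proof.
have m0 : 0 <= mean move_prob / (1 - a).
  rewrite divr_ge0 ?subr_ge0 ?(ltW a_lt1)// sumr_ge0// => s _.
  by rewrite mulr_ge0// sumr_ge0.
elim: k L f => [|k IHk] L f Lf.
  rewrite muln0 expr0 mulr1 mulrDr; apply: ler_wpDl.
    by rewrite mulr_ge0 ?sqr_ge0.
  rewrite /var -[leRHS]mean_cst; apply: ler_mean => s.
  rewrite -[leLHS]real_normK ?num_real// -exprMn mulrC lerXn2r ?nnegrE//.
    exact: le_trans (diameter Lf s s).
  rewrite -[X in X - _]mean_cst -meanB.
  apply: le_trans (ler_norm_mean _) _; rewrite -[leRHS]mean_cst.
  by apply: ler_mean => t; exact: diameter.
apply: le_trans (var_step_decomposition f) _.
have := IHk _ _ (contraction Lf).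
have : mean (increment2 f) <= L ^+ 2 * mean move_prob.
  by rewrite -meanZ; apply: ler_mean => s; exact: increment2_le_move.
move: m0; set m := mean move_prob => m0 incr IH.
apply: le_trans (lerD incr IH) _.
have am : m + a * (m / (1 - a)) = m / (1 - a).
  by field; rewrite subr_eq0 gt_eqF.
have aam : a ^+ 2 * (m / (1 - a)) <= a * (m / (1 - a)).
  by rewrite ler_wpM2r// expr2 ler_piMr// ltW.
rewrite mulnS exprD exprMn [a ^+ 2 * L ^+ 2]mulrC.
rewrite -[L ^+ 2 * a ^+ 2 * _]mulrA -mulrDr ler_wpM2l ?sqr_ge0//.
rewrite -[in leRHS]am; move: aam; lra.
Qed.

Lemma var_lipschitz L f : lipschitz L f ->
  var f <= L ^+ 2 * (mean move_prob / (1 - a)).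
Proof.
move=> Lf; rewrite -[X in _ * X]addr0 -(mulr0 (D ^+ 2)).
have cv : (fun k => L ^+ 2 * (mean move_prob / (1 - a)
    + D ^+ 2 * (a ^+ 2) ^+ k)) @ \oo -->
    L ^+ 2 * (mean move_prob / (1 - a) + D ^+ 2 * 0).
  apply: cvgMl_tmp; apply: cvgD; first exact: cvg_cst.
  apply: cvgMl_tmp; apply: cvg_expr.
  by rewrite ger0_norm ?sqr_ge0// expr2 (le_lt_trans _ a_lt1)// ler_piMr// ltW.
rewrite -(cvg_lim _ cv)//; apply: limr_ge; first exact: cvgP cv.
by apply: nearW => k; rewrite -exprM; exact: var_lipschitz_iter.
Qed.

End Contraction.

Section LinearRegression.
Variables (W : T -> R) (lam : R).
Hypothesis lam_gt0 : 0 < lam.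
Hypothesis regression : forall s, step W s = (1 - lam) * W s.

Let drift s : \sum_t K s t * (W t - W s) = - (lam * W s).
Proof.
under eq_bigr do rewrite mulrBr.
by rewrite sumrB -mulr_suml K_sum1 -/(step W s) regression; ring.
Qed.

Lemma regression_mean0 : mean W = 0.
Proof.
have : mean (step W) = (1 - lam) * mean W.
  by rewrite -meanZ; exact: eq_mean.
rewrite mean_step => EW; have /eqP : lam * mean W = 0 by lra.
by rewrite mulf_eq0 gt_eqF//= => /eqP.
Qed.

Lemma regression_increment2 :
  mean (increment2 W) = 2 * lam * mean (fun s => W s ^+ 2).
Proof.
have sqrE s : step (fun t => W t ^+ 2) s =
    W s ^+ 2 - 2 * lam * W s ^+ 2 + increment2 W s.
  have -> : W s ^+ 2 - 2 * lam * W s ^+ 2 =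
      \sum_t K s t * W s ^+ 2 + 2 * W s * \sum_t K s t * (W t - W s).
    by rewrite drift -mulr_suml K_sum1; ring.
  rewrite mulr_sumr -!big_split/=; apply: eq_bigr => t _; ring.
have := mean_step (fun t => W t ^+ 2).
by rewrite (eq_mean _ sqrE) meanD meanB meanZ; lra.
Qed.

(** Expand 0 = E[G(W') - G(W)] to second order.  The first order term is
    - lam E[W f(W)] by the regression property; in the second order term the
    conditional mean square displacement is replaced by its mean 2 lam, at the
    cost of its L1 fluctuation; the remainder is at most |f''| times the
    largest jump times the mean square displacement. *)
Lemma stein_regression (D d : R) :
  (forall s t, K s t != 0 -> `|W t - W s| <= D) -> 2 * D <= d ->
  mean (fun s => W s ^+ 2) = 1 ->
  mean (fun s => `|increment2 W s - 2 * lam|) <= 2 * lam * d ->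
  stein_discrepancy mu W d.
Proof.
move=> jump Dd W2 conc G f f' f'' B1 B2 DG Df Df' f'B1 f''B2.
have B2_ge0 : 0 <= B2 by exact: le_trans (f''B2 0).
have B1_ge0 : 0 <= B1 by exact: le_trans (f'B1 0).
have mi2 : mean (increment2 W) = 2 * lam.
  by rewrite regression_increment2 W2 mulr1.
pose rem s t := G (W t) - G (W s)
  - (f (W s) * (W t - W s) + f' (W s) * (W t - W s) ^+ 2 / 2).
pose r s := \sum_t K s t * rem s t.
have stepG s : step (G \o W) s = G (W s)
    + (f' (W s) * (increment2 W s / 2) - lam * (W s * f (W s)) + r s).
  have -> : f' (W s) * (increment2 W s / 2) - lam * (W s * f (W s)) =
      f (W s) * (\sum_t K s t * (W t - W s)) + f' (W s) / 2 * increment2 W s.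
    by rewrite drift; ring.
  have -> : G (W s) = \sum_t K s t * G (W s) by rewrite -mulr_suml K_sum1 mul1r.
  rewrite !mulr_sumr -!big_split/=; apply: eq_bigr => t _.
  by rewrite /rem /=; field.
have r_le s : `|r s| <= B2 * D * increment2 W s.
  apply: le_trans (ler_norm_sum _ _ _) _.
  rewrite mulr_sumr; apply: ler_sum => t _.
  have [->|Kst] := eqVneq (K s t) 0; first by rewrite !mul0r normr0 mulr0.
  rewrite normrM ger0_norm// mulrCA ler_wpM2l//.
  apply: le_trans (taylor3_bound _ _ DG Df Df' f''B2) _.
  rewrite -mulrA ler_wpM2l// exprSr mulrC real_normK ?num_real//.
  by rewrite ler_wpM2r ?sqr_ge0// jump.
have := mean_step (G \o W); rewrite (eq_mean _ stepG) meanD.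
rewrite -[X in _ = X]addr0 => /addrI mean0.
have main : lam * mean (fun s => f' (W s) - W s * f (W s)) =
    mean (fun s => f' (W s) * (2^-1 * (2 * lam - increment2 W s)) - r s).
  rewrite -[RHS]addr0 -[X in _ + X]mean0 -meanD -meanZ.
  by apply: eq_mean => s; field.
rewrite -[X in X <= _]/(`|mean (fun s => f' (W s) - W s * f (W s))|).
rewrite -(ler_pM2l lam_gt0) -[X in X * `|_|](gtr0_norm lam_gt0) -normrM main.
apply: le_trans (ler_norm_mean _) _.
apply: (@le_trans _ _ (mean (fun s =>
  B1 / 2 * `|increment2 W s - 2 * lam| + B2 * D * increment2 W s))).
  apply: ler_mean => s; apply: le_trans (ler_normB _ _) _.
  rewrite lerD// normrM -mulrA ler_pM// normrM distrC ler_wpM2r//.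
  by rewrite ger0_norm// invr_ge0.
rewrite meanD !meanZ mi2.
have : B1 / 2 * mean (fun s => `|increment2 W s - 2 * lam|)
    <= B1 / 2 * (2 * lam * d) by rewrite ler_wpM2l// divr_ge0.
have : B2 * lam * (2 * D) <= B2 * lam * d.
  by rewrite ler_wpM2l// mulr_ge0// ltW.
lra.
Qed.

End LinearRegression.

End FiniteChain.

(** * The noisy voter model on a doubly stochastic matrix *)

Section Voter.
Context {R : realType} {V : finType}.
Variables (P : V -> V -> R) (p : R).
Hypothesis P_ge0 : forall x y, 0 <= P x y.
Hypothesis P_row : forall x, \sum_y P x y = 1.
Hypothesis P_col : forall y, \sum_x P x y = 1.
Hypothesis P_diag : forall x, P x x = 0.
Hypothesis p_gt0 : 0 < p.
Hypothesis p_le1 : p <= 1.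
Hypothesis V_gt0 : (0 < #|V|)%N.
Implicit Types (xi eta : config V) (x y z : V) (b c : bool).
Implicit Types f : config V -> R.

Local Notation n := (#|V|%:R : R).

Let n_gt0 : 0 < n. Proof. by rewrite ltr0n. Qed.
Let q_ge0 : 0 <= 1 - p. Proof. by rewrite subr_ge0. Qed.

Lemma updateE xi x b z : update xi x b z = if z == x then b else xi z.
Proof. by rewrite ffunE. Qed.

Lemma update_id xi x : update xi x (xi x) = xi.
Proof. by apply/ffunP => z; rewrite updateE; case: eqP => // ->. Qed.

Lemma update_update xi x b c : update (update xi x b) x c = update xi x c.
Proof. by apply/ffunP => z; rewrite !updateE; case: eqP. Qed.

Lemma updateC xi x z b c : x != z ->
  update (update xi z c) x b = update (update xi x b) z c.
Proof.
move=> xz; apply/ffunP => w; rewrite !updateE.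
by have [->|//] := eqVneq w x; rewrite (negPf xz).
Qed.

(** The transition matrix in the form of its action on functions, in which the
    contraction and the drift can be read off vertex by vertex. *)
Lemma step_nvm f xi : step (nvm P p) f xi =
  \sum_x n^-1 * (p * (\sum_(b : bool) 2^-1 * f (update xi x b))
    + (1 - p) * (\sum_y P x y * f (update xi x (xi y)))).
Proof.
have pick (eta : config V) : \sum_zeta (zeta == eta)%:R * f zeta = f eta.
  rewrite (bigD1 eta)//= eqxx mul1r big1 ?addr0// => zeta /negPf ->.
  by rewrite mul0r.
rewrite /step /nvm; under eq_bigr do rewrite mulr_suml.
rewrite exchange_big/=; apply: eq_bigr => x _.
under eq_bigr do rewrite -mulrA.
rewrite -mulr_sumr; congr (_ * _).
under [LHS]eq_bigr do rewrite mulrDl -!mulrA !mulr_suml.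
rewrite big_split/=; congr (_ + _); rewrite -mulr_sumr; congr (_ * _).
  rewrite exchange_big/=; apply: eq_bigr => b _.
  by under eq_bigr do rewrite -mulrA; rewrite -mulr_sumr pick.
rewrite exchange_big/=; apply: eq_bigr => y _.
by under eq_bigr do rewrite -mulrA; rewrite -mulr_sumr pick.
Qed.

Lemma nvm_ge0 xi eta : 0 <= nvm P p xi eta.
Proof.
rewrite /nvm; apply: sumr_ge0 => x _; apply: mulr_ge0.
  by rewrite invr_ge0 ltW.
apply: addr_ge0; apply: mulr_ge0 => //; first exact: ltW.
  by apply: sumr_ge0 => b _; rewrite mulr_ge0 ?invr_ge0.
by apply: sumr_ge0 => y _; rewrite mulr_ge0.
Qed.

Lemma nvm_average (c : R) : \sum_(x : V) n^-1 * c = c.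
Proof.
rewrite sumr_const -[LHS]mulr_natl cardT -cardE.
by rewrite mulrA divff ?mul1r// gt_eqF.
Qed.

Lemma nvm_sum1 xi : \sum_eta nvm P p xi eta = 1.
Proof.
have := step_nvm (fun=> 1) xi; rewrite /step.
under eq_bigr do rewrite mulr1.
move=> ->; rewrite -[RHS]nvm_average; apply: eq_bigr => x _; congr (_ * _).
under eq_bigr do rewrite mulr1; rewrite big_bool/=.
by under eq_bigr do rewrite mulr1; rewrite P_row; field.
Qed.

(** Rewriting an opinion with itself is included, as the chain may stay put. *)
Definition single_flip : rel (config V) :=
  fun xi eta => [exists x, exists b, eta == update xi x b].

Lemma nvm_single_flip xi eta : nvm P p xi eta != 0 -> single_flip xi eta.
Proof.
apply: contraR => /existsPn flip; rewrite /nvm big1// => x _.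
have out b : (eta == update xi x b) = false.
  by apply/negbTE; have /existsPn := flip x; apply.
rewrite !big1 ?mulr0 ?addr0 ?mulr0// => y _; by rewrite out mulr0.
Qed.

Lemma lipschitzP (L : R) f : lipschitz single_flip L f <->
  forall xi x b, `|f (update xi x b) - f xi| <= L.
Proof.
split=> [Lf xi x b|Lf xi eta /existsP[x /existsP[b /eqP ->]]]; last exact: Lf.
by apply: Lf; apply/existsP; exists x; apply/existsP; exists b.
Qed.

(** Any two configurations are joined by rewriting the vertices one by one. *)
Lemma nvm_diameter (L : R) f : lipschitz single_flip L f ->
  forall xi eta, `|f eta - f xi| <= n * L.
Proof.
move=> /lipschitzP Lf xi eta.
pose glue (s : seq V) := foldr (fun x xi' => update xi' x (eta x)) xi s.
have glueE s z : glue s z = if z \in s then eta z else xi z.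
  elim: s => //= x s IHs; rewrite updateE IHs in_cons.
  by have [->|] := eqVneq z x.
have -> : eta = glue (enum V).
  by apply/ffunP => z; rewrite glueE mem_enum.
rewrite cardE; elim: (enum V) => [|x s IHs] /=.
  by rewrite subrr normr0 mul0r.
rewrite -natr1 mulrDl mul1r [leRHS]addrC.
by apply: le_trans (ler_distD (f (glue s)) _ _) _; rewrite lerD.
Qed.

(** Path coupling.  Run the chain from xi and from xi with the opinion of z
    changed, using the same vertex, the same coin and the same neighbour.  The
    discrepancy at z disappears when z is updated, with probability 1/n, and
    spreads to a second vertex when some x copies z, with probability
    (1 - p)/n in total since the columns of P sum to 1.  The expected number of
    discrepancies is thus 1 - 1/n + (1 - p)/n = 1 - p/n. *)
Lemma nvm_contraction (L : R) f : lipschitz single_flip L f ->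
  lipschitz single_flip ((1 - p / n) * L) (step (nvm P p) f).
Proof.
move=> /lipschitzP Lf; apply/lipschitzP => xi z c.
have L0 : 0 <= L by exact: le_trans (Lf xi z c).
set xi' := update xi z c.
have same x b : x != z -> `|f (update xi' x b) - f (update xi x b)| <= L.
  by move=> xz; rewrite updateC.
have copy x y : x != z -> `|f (update xi' x (xi' y)) - f (update xi x (xi y))|
    <= L * (1 + (y == z)%:R).
  move=> xz; have [->|yz] := eqVneq y z; last first.
    by rewrite addr0 mulr1 {2}/xi' updateE (negPf yz) same.
  rewrite {2}/xi' updateE eqxx mulrDr mulr1.
  apply: le_trans (ler_distD (f (update xi x c)) _ _) _.
  (* Change the opinion of z, then that of x from xi z to c. *)
  by rewrite lerD ?same// -[update xi x c](update_update _ _ (xi z)).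
have termz : \sum_(b : bool) 2^-1 * f (update xi' z b) =
    \sum_(b : bool) 2^-1 * f (update xi z b) /\
    \sum_y P z y * f (update xi' z (xi' y)) =
    \sum_y P z y * f (update xi z (xi y)).
  split; first by apply: eq_bigr => b _; rewrite update_update.
  apply: eq_bigr => y _; have [->|yz] := eqVneq y z.
    by rewrite P_diag !mul0r.
  by rewrite update_update {1}/xi' updateE (negPf yz).
(* Nothing survives of the term where z itself is updated. *)
rewrite !step_nvm -sumrB (bigD1 z)//= !termz.1 !termz.2 subrr add0r.
apply: (@le_trans _ _ (\sum_(x | x != z)
    n^-1 * (L * (1 + (1 - p) * P x z)))).
  apply: le_trans (ler_norm_sum _ _ _) _; apply: ler_sum => x xz.
  rewrite -mulrBr normrM ger0_norm ?invr_ge0 ?(ltW n_gt0)//.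
  rewrite ler_wpM2l ?invr_ge0 ?(ltW n_gt0)// opprD addrACA -!mulrBr.
  have -> : L * (1 + (1 - p) * P x z) =
    p * L + (1 - p) * (L * (1 + P x z)) by ring.
  apply: le_trans (ler_normD _ _) _.
  rewrite !normrM (gtr0_norm p_gt0) (ger0_norm q_ge0).
  rewrite lerD// ler_wpM2l ?(ltW p_gt0)//.
    rewrite !big_bool/=.
    have := same x true xz; have := same x false xz.
    by rewrite !ler_norml => /andP[? ?] /andP[? ?]; apply/andP; split; lra.
  rewrite -sumrB; apply: le_trans (ler_norm_sum _ _ _) _.
  have -> : L * (1 + P x z) = \sum_y P x y * (L * (1 + (y == z)%:R)).
    under [RHS]eq_bigr do rewrite mulrCA mulrDr mulr1.
    rewrite -mulr_sumr big_split/= P_row; congr (_ * (_ + _)).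
    rewrite (bigD1 z)//= eqxx mulr1 big1 ?addr0// => y /negPf ->.
    by rewrite mulr0.
  apply: ler_sum => y _; rewrite -mulrBr normrM ger0_norm//.
  by rewrite ler_wpM2l// copy.
rewrite -mulr_sumr -mulr_sumr big_split/= -mulr_sumr.
have -> : \sum_(x | x != z) 1 = n - 1 :> R.
  rewrite sumr_const -[in RHS]cardsT (cardsD1 z) inE/= natrD addrC addKr.
  by rewrite -cardsE; congr (_%:R); apply: eq_card => x; rewrite !inE andbT.
have -> : \sum_(x | x != z) P x z = 1.
  by rewrite -[RHS](P_col z) [RHS](bigD1 z)//= P_diag add0r.
by rewrite le_eqVlt; apply/orP; left; apply/eqP; field; rewrite gt_eqF.
Qed.

Definition spin b : R := if b then 1 else -1.

Definition magnetization xi := \sum_x spin (xi x).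

Lemma magnetization_update xi x b :
  magnetization (update xi x b) - magnetization xi = spin b - spin (xi x).
Proof.
rewrite /magnetization -sumrB (bigD1 x)//= updateE eqxx big1 ?addr0// => z zx.
by rewrite updateE (negPf zx) subrr.
Qed.

Lemma magnetization_jump xi eta : nvm P p xi eta != 0 -> eta != xi ->
  `|magnetization eta - magnetization xi| = 2.
Proof.
move=> /nvm_single_flip/existsP[x /existsP[b /eqP ->]] moved.
rewrite magnetization_update.
have : b != xi x by apply: contraNneq moved => ->; rewrite update_id.
case: b {moved}; case: (xi x) => //= _; rewrite /spin.
  by rewrite opprK ger0_norm.
by rewrite -opprD normrN ger0_norm.
Qed.

(** A coin flip kills the spin of x on average, and copying preserves the total
    spin on average because the columns of P sum to 1. *)
Lemma nvm_linear_drift xi : step (nvm P p) magnetization xi =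
  (1 - p / n) * magnetization xi.
Proof.
have fresh x : \sum_(b : bool) 2^-1 * magnetization (update xi x b) =
    magnetization xi - spin (xi x).
  have := magnetization_update xi x true.
  have := magnetization_update xi x false.
  by rewrite big_bool/=; lra.
have copied x : \sum_y P x y * magnetization (update xi x (xi y)) =
    magnetization xi - spin (xi x) + \sum_y P x y * spin (xi y).
  rewrite -[X in X + _]mul1r -[X in X * _](P_row x) mulr_suml -big_split/=.
  apply: eq_bigr => y _; rewrite -mulrDr; congr (_ * _).
  by have := magnetization_update xi x (xi y); lra.
rewrite step_nvm.
under eq_bigr => x _.
  rewrite fresh copied.
  rewrite (_ : _ * _ = n^-1 * magnetization xi + (- n^-1 * spin (xi x)
    + (1 - p) / n * \sum_y P x y * spin (xi y))); last by ring.
  over.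
rewrite !big_split/= nvm_average -!mulr_sumr -/(magnetization xi).
have -> : \sum_x \sum_y P x y * spin (xi y) = magnetization xi.
  rewrite exchange_big/=; apply: eq_bigr => y _.
  by rewrite -mulr_suml P_col mul1r.
by field; rewrite gt_eqF.
Qed.

(** Every actual jump of the magnetization has square 4.  This is what keeps the
    probability of moving in the variance bound, where it will cancel against
    the normalisation by E[V]. *)
Lemma increment2_move xi :
  increment2 (nvm P p) magnetization xi = 4 * move_prob (nvm P p) xi.
Proof.
rewrite /increment2 /move_prob (bigD1 xi)//= subrr expr0n mulr0 add0r.
rewrite mulr_sumr; apply: eq_bigr => eta moved; rewrite mulrC.
have [->|Kne] := eqVneq (nvm P p xi eta) 0; first by rewrite !mulr0.
congr (_ * _); rewrite -[LHS]real_normK ?num_real//.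
by rewrite magnetization_jump//; ring.
Qed.

(* 4 times the indicator that two opinions differ. *)
Let disagree b c : R := (spin b - spin c) ^+ 2.

Let disagree_ge0 b c : 0 <= disagree b c. Proof. exact: sqr_ge0. Qed.

Let disagree_le4 b c : disagree b c <= 4.
Proof. by rewrite /disagree /spin; case: b; case: c; lra. Qed.

Lemma increment2_nvm xi : increment2 (nvm P p) magnetization xi =
  2 * p + \sum_x n^-1 * ((1 - p) * \sum_y P x y * disagree (xi y) (xi x)).
Proof.
have -> : increment2 (nvm P p) magnetization xi =
  step (nvm P p) (fun eta => (magnetization eta - magnetization xi) ^+ 2) xi.
  by [].
rewrite step_nvm -[2 * p]nvm_average -big_split/=; apply: eq_bigr => x _.
rewrite -mulrDr; congr (_ * (_ + _)).
  rewrite big_bool/= !magnetization_update /spin; case: (xi x); by field.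
by congr (_ * _); apply: eq_bigr => y _; rewrite magnetization_update.
Qed.

(** A fresh coin changes the opinion half of the time, whatever it was. *)
Lemma increment2_ge xi :
  2 * p <= increment2 (nvm P p) magnetization xi.
Proof.
rewrite increment2_nvm lerDl sumr_ge0// => x _.
rewrite mulr_ge0 ?invr_ge0 ?(ltW n_gt0)// mulr_ge0// sumr_ge0// => y _.
by rewrite mulr_ge0.
Qed.

(** Changing the opinion of z affects the pairs (z, y) and (x, z), whose weights
    P z y and P x z have total mass 2; each pair changes by at most 4. *)
Lemma nvm_increment2_lipschitz :
  lipschitz single_flip (8 / n) (increment2 (nvm P p) magnetization).
Proof.
apply/lipschitzP => xi z c; set xi' := update xi z c.
rewrite !increment2_nvm opprD addrACA subrr add0r -sumrB.
apply: (@le_trans _ _ (\sum_x n^-1 * (4 * ((x == z)%:R + P x z)))).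
  apply: le_trans (ler_norm_sum _ _ _) _; apply: ler_sum => x _.
  rewrite -mulrBr normrM ger0_norm ?invr_ge0 ?(ltW n_gt0)//.
  rewrite ler_wpM2l ?invr_ge0 ?(ltW n_gt0)// -mulrBr normrM ger0_norm//.
  apply: (@le_trans _ _ (1 * (4 * ((x == z)%:R + P x z)))); last first.
    by rewrite mul1r.
  rewrite ler_pM//; first by rewrite gerBl ltW.
  rewrite -sumrB; apply: le_trans (ler_norm_sum _ _ _) _.
  have -> : 4 * ((x == z)%:R + P x z) =
      \sum_y P x y * (4 * ((x == z)%:R + (y == z)%:R)).
    under [RHS]eq_bigr do rewrite mulrCA mulrDr.
    rewrite -mulr_sumr big_split/= -mulr_suml P_row mul1r; congr (_ * (_ + _)).
    rewrite (bigD1 z)//= eqxx mulr1 big1 ?addr0// => y /negPf ->.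
    by rewrite mulr0.
  apply: ler_sum => y _; rewrite -mulrBr normrM ger0_norm// ler_wpM2l//.
  rewrite /xi' !updateE; have [xz|xz] := eqVneq x z; last first.
    have [yz|yz] := eqVneq y z; last by rewrite subrr normr0 addr0 mulr0.
    rewrite add0r mulr1 ler_norml.
    by have := disagree_ge0 c (xi x); have := disagree_le4 c (xi x);
       have := disagree_ge0 (xi y) (xi x); have := disagree_le4 (xi y) (xi x);
       lra.
  apply: (@le_trans _ _ 4); last by rewrite mulrDr mulr1 lerDl mulr_ge0.
  rewrite ler_norml; set u := disagree _ _; set v := disagree _ _.
  have : 0 <= u <= 4 by rewrite disagree_ge0 disagree_le4.
  have : 0 <= v <= 4 by rewrite disagree_ge0 disagree_le4.
  lra.
rewrite -!mulr_sumr big_split/= P_col.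
have -> : \sum_x (x == z)%:R = 1 :> R.
  by rewrite (bigD1 z)//= eqxx big1 ?addr0// => x /negPf ->.
by rewrite mulrC le_eqVlt; apply/orP; left; apply/eqP; ring.
Qed.

Variable mu : config V -> R.
Hypothesis mu_stationary : stationary (nvm P p) mu.

Let mu_ge0 s : 0 <= mu s. Proof. by case: mu_stationary. Qed.
Let mu_sum1 : \sum_s mu s = 1. Proof. by case: mu_stationary. Qed.

Local Notation second_moment :=
  (mean mu (fun xi => magnetization xi ^+ 2)).
Local Notation V2 := (increment2 (nvm P p) magnetization).

Let pn_gt0 : 0 < p / n. Proof. exact: divr_gt0. Qed.

Lemma nvm_magnetization_mean0 : mean mu magnetization = 0.
Proof. exact: (regression_mean0 mu_stationary pn_gt0 nvm_linear_drift). Qed.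

Let mean_V2 : mean mu V2 = 2 * (p / n) * second_moment.
Proof.
exact: (regression_increment2 nvm_sum1 mu_stationary nvm_linear_drift).
Qed.

Let mean_V2_ge : 2 * p <= mean mu V2.
Proof.
rewrite -[leLHS](mean_cst mu_sum1); apply: ler_mean.
  exact: mu_ge0.
exact: increment2_ge.
Qed.

Lemma second_moment_ge : n <= second_moment.
Proof.
have := mean_V2_ge; rewrite mean_V2.
have -> : 2 * (p / n) * second_moment = 2 * p * (second_moment / n).
  by field; rewrite gt_eqF.
by rewrite ler_pMr ?mulr_gt0// ler_pdivlMr// mul1r.
Qed.

Let m2_gt0 : 0 < second_moment.
Proof. exact: lt_le_trans second_moment_ge. Qed.

(** [var_lipschitz] with L = 8/n and a = 1 - p/n, the probability of moving
    being E[V]/4. *)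
Lemma var_increment2 : var mu V2 <= 16 * mean mu V2 / (n * p).
Proof.
have a_ge0 : 0 <= 1 - p / n.
  by rewrite subr_ge0 ler_pdivrMr// mul1r (le_trans p_le1)// ler1n.
have a_lt1 : 1 - p / n < 1 by rewrite gtrBl.
apply: le_trans (var_lipschitz nvm_ge0 nvm_sum1 mu_stationary a_ge0 a_lt1
  nvm_single_flip nvm_contraction nvm_diameter nvm_increment2_lipschitz) _.
have -> : mean mu V2 = 4 * mean mu (move_prob (nvm P p)).
  by rewrite -meanZ; apply: eq_mean => xi; exact: increment2_move.
rewrite le_eqVlt; apply/orP; left; apply/eqP; field.
by rewrite !gt_eqF// opprB addrC subrK.
Qed.

Lemma increment2_concentration : mean mu (fun xi => `|V2 xi - mean mu V2|) <=
  3 * mean mu V2 / (p * Num.sqrt n).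
Proof.
have sn : 0 < Num.sqrt n by rewrite sqrtr_gt0.
have nE : n = Num.sqrt n ^+ 2 by rewrite sqr_sqrtr// ltW.
have EV0 : 0 < mean mu V2 by rewrite (lt_le_trans _ mean_V2_ge)// mulr_gt0.
(* The right order of magnitude, as Var V <= 16 E[V]/(np) and p <= E[V]/2. *)
set k := 4 * mean mu V2 / (p * Num.sqrt n).
have k0 : 0 < k by rewrite divr_gt0 ?mulr_gt0.
apply: le_trans (mean_norm_le_var mu_ge0 mu_sum1 _ k0) _.
have : var mu V2 / k <= 2 * mean mu V2 / (p * Num.sqrt n).
  rewrite ler_pdivrMr//; apply: le_trans var_increment2 _.
  have -> : 2 * mean mu V2 / (p * Num.sqrt n) * k =
      8 * mean mu V2 / (n * p ^+ 2) * mean mu V2.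
    by rewrite /k [in RHS]nE; field; rewrite !gt_eqF.
  have -> : 16 * mean mu V2 / (n * p) =
      8 * mean mu V2 / (n * p ^+ 2) * (2 * p).
    by field; rewrite !gt_eqF.
  by rewrite ler_wpM2l// divr_ge0 ?mulr_ge0 ?exprn_ge0 ?(ltW EV0) ?(ltW p_gt0).
rewrite /k; set u := mean mu V2 / (p * Num.sqrt n).
by rewrite -![_ * mean mu V2 / _]mulrA -/u; lra.
Qed.

Lemma nvm_stein_discrepancy :
  stein_discrepancy mu (fun xi => magnetization xi / Num.sqrt second_moment)
    (4 / (p * Num.sqrt n)).
Proof.
set sd := Num.sqrt second_moment.
have sd0 : 0 < sd by rewrite sqrtr_gt0.
have sdE : sd ^+ 2 = second_moment by rewrite sqr_sqrtr// ltW.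
have sn : 0 < Num.sqrt n by rewrite sqrtr_gt0.
have sn_sd : Num.sqrt n <= sd by rewrite ler_wsqrtr// second_moment_ge.
have stepZ xi : step (nvm P p) (fun eta => magnetization eta / sd) xi =
    (1 - p / n) * (magnetization xi / sd).
  rewrite mulrA -nvm_linear_drift /step mulr_suml.
  by apply: eq_bigr => eta _; rewrite mulrA.
have incZ xi : increment2 (nvm P p) (fun eta => magnetization eta / sd) xi =
    second_moment^-1 * V2 xi.
  rewrite /increment2 mulr_sumr; apply: eq_bigr => eta _.
  by rewrite -mulrBl exprMn -sdE exprVn; ring.
apply: (stein_regression nvm_ge0 nvm_sum1 mu_stationary pn_gt0 stepZ
  (D := 2 / sd)).
- move=> xi eta Kne; rewrite -mulrBl normrM [X in _ * X]ger0_norm; last first.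
    by rewrite invr_ge0 ltW.
  rewrite ler_wpM2r ?invr_ge0 ?(ltW sd0)//.
  have [->|moved] := eqVneq eta xi; first by rewrite subrr normr0.
  by rewrite magnetization_jump.
- rewrite mulrA -natrM ler_wpM2l// lef_pV2 ?posrE ?mulr_gt0//.
  by apply: le_trans sn_sd; rewrite ler_piMl// ltW.
- under eq_mean do rewrite exprMn exprVn sdE mulrC.
  by rewrite meanZ mulVf// gt_eqF.
- rewrite (@eq_mean _ _ _ _ (fun xi => second_moment^-1 *
    `|V2 xi - mean mu V2|)); last first.
    move=> xi; rewrite incZ mean_V2 -[X in X * `|_|]ger0_norm; last first.
      by rewrite invr_ge0 ltW.
    rewrite -normrM; congr `|_|; field; rewrite !gt_eqF//.
  rewrite meanZ; apply: le_trans (_ : second_moment^-1 *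
    (3 * mean mu V2 / (p * Num.sqrt n)) <= _).
    by rewrite ler_wpM2l ?invr_ge0 ?(ltW m2_gt0) ?increment2_concentration.
  have -> : second_moment^-1 * (3 * mean mu V2 / (p * Num.sqrt n)) =
      2 * (p / n) * (3 / (p * Num.sqrt n)).
    by rewrite mean_V2; field; rewrite !gt_eqF.
  apply: ler_wpM2l; first by rewrite mulr_ge0 ?(ltW pn_gt0).
  apply: ler_wpM2r; first by rewrite invr_ge0 mulr_ge0 ?(ltW p_gt0) ?(ltW sn).
  by rewrite ler_nat.
Qed.

End Voter.

(** * Random walk on a connected regular graph *)

Section RandomWalk.
Context {R : realType} {V : finType}.
Variable e : rel V.
Hypothesis e_simple : simple_graph e.
Hypothesis e_connected : connected_graph e.
Hypothesis e_regular : regular_graph e.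
Hypothesis V_gt1 : (1 < #|V|)%N.

Local Notation P := (rw_matrix R e).

Lemma degree_gt0 x : (0 < #|e x|)%N.
Proof.
have : (0 < #|predC1 x|)%N by rewrite cardC1 -subn1 subn_gt0.
move=> /card_gt0P[y]; rewrite inE => yx.
have /connectP[[|z s] /= epath ylast] := e_connected x y.
  by rewrite ylast eqxx in yx.
by apply/card_gt0P; exists z; case/andP: epath.
Qed.

Lemma rw_matrix_ge0 x y : 0 <= P x y.
Proof. by rewrite /rw_matrix divr_ge0. Qed.

Lemma rw_matrix_diag x : P x x = 0.
Proof. by rewrite /rw_matrix e_simple.2 mul0r. Qed.

Lemma rw_matrix_sym x y : P x y = P y x.
Proof.
by have [d deg] := e_regular; rewrite /rw_matrix !deg e_simple.1.
Qed.

Lemma rw_matrix_row x : \sum_y P x y = 1.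
Proof.
rewrite /rw_matrix -mulr_suml -natr_sum -big_mkcond sum1_card.
by rewrite divff// pnatr_eq0 -lt0n degree_gt0.
Qed.

Lemma rw_matrix_col y : \sum_x P x y = 1.
Proof. by under eq_bigr do rewrite rw_matrix_sym; exact: rw_matrix_row. Qed.

(** Maximum principle: by symmetry pi is harmonic, so its maximum propagates
    from a vertex to its neighbours. *)
Lemma stationary_uniform (pi : V -> R) : stationary P pi ->
  forall x, pi x = #|V|%:R^-1.
Proof.
move=> [_ pi1 piP].
have /card_gt0P[x0 _] : (0 < #|V|)%N by exact: ltnW.
pose m := [arg max_(m > x0) pi m]%O.
have max z : pi z <= pi m by rewrite /m; case: arg_maxP => // i _; apply.
have spread x y : e x y -> pi y = pi m -> pi x = pi m.
  move=> exy ym; have defect : \sum_z (pi m - pi z) * P z y = 0.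
    under eq_bigr do rewrite mulrBl.
    by rewrite sumrB -mulr_sumr rw_matrix_col piP ym mulr1 subrr.
  have /(_ x isT)/eqP := psumr_eq0P (fun z _ =>
    mulr_ge0 (etrans (subr_ge0 _ _) (max z)) (rw_matrix_ge0 z y)) defect.
  rewrite mulf_eq0 subr_eq0 => /orP[/eqP -> //|].
  by rewrite /rw_matrix exy mul1r invr_eq0 pnatr_eq0 eqn0Ngt degree_gt0.
have const x : pi x = pi m.
  have clo : closed_mem e (mem [pred z | pi z == pi m]).
    move=> y z eyz; rewrite !inE; apply/eqP/eqP; apply: spread => //.
    by rewrite e_simple.1.
  have := closed_connect clo (e_connected m x).
  by rewrite !inE eqxx => /esym/eqP.
have n0 : #|V|%:R != 0 :> R by rewrite pnatr_eq0 -lt0n ltnW.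
move=> x; rewrite const; move: pi1; under eq_bigr do rewrite const.
rewrite sumr_const cardT -cardE -[LHS]mulr_natr => mass1.
by rewrite -[LHS](mulfK n0) mass1 mul1r.
Qed.

End RandomWalk.

(** * Expectations over configurations *)

Section FiniteExpectation.
Context {R : realType} {V : finType}.
Variable Gamma : probability (config V) R.

Definition mass (xi : config V) : R := fine (Gamma [set xi]).

Lemma expectation_config (f : config V -> R) :
  ('E_Gamma[f] = (mean mass f)%:E)%E.
Proof.
rewrite unlock /mean -sumEFin.
pose g (xi w : config V) : \bar R := ((f xi)%:E * (\1_[set xi] w)%:E)%E.
have ii (xi : config V) :
    Gamma.-integrable setT (fun w => (\1_[set xi] w : R)%:E).
  exact: integrable_indic.
have ig xi : Gamma.-integrable setT (g xi) by exact: integrableZl.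
transitivity (\int[Gamma]_w \sum_xi g xi w)%E.
  apply: eq_integral => w _; rewrite (bigD1 w)//= big1 ?adde0.
    by rewrite /g indicE mem_set// mule1.
  move=> xi xiw; rewrite /g indicE memNset ?mule0// => /= wxi.
  by rewrite wxi eqxx in xiw.
rewrite integral_sum//; apply: eq_bigr => xi _.
rewrite integralZl// integral_indic// setIT -[X in (_ * X)%E]fineK.
  by rewrite -EFinM mulrC.
exact: fin_num_measure.
Qed.

Lemma cdf_config (X : {RV Gamma >-> R}) (t : R) :
  cdf X t = (mean mass (fun xi => (X xi <= t)%R%:R))%:E.
Proof.
rewrite -expectation_config.
rewrite [X in expectation _ X](_ : _ = \1_(X @^-1` `]-oo, t]%classic)).
  by rewrite expectation_indic.
apply/funext => xi; rewrite indicE; congr (_%:R); congr nat_of_bool.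
by apply/idP/idP; rewrite inE /= in_itv/=.
Qed.

Lemma variance_config (f : config V -> R) :
  ('V_Gamma[f] = (var mass f)%:E)%E.
Proof.
rewrite /variance covariance.unlock expectation_config; congr (_%:E).
by rewrite expectation_config /=; apply: eq_mean => xi /=; rewrite expr2.
Qed.

Hypothesis mass_sum1 : \sum_xi mass xi = 1.

(** The affine change from opinions to spins, S = M / (2n) + 1/2, disappears in
    the normalisation. *)
Lemma nvm_W_magnetization (V_gt0 : (0 < #|V|)%N) (pi : V -> R) :
  (forall x, pi x = #|V|%:R^-1) ->
  mean mass magnetization = 0 ->
  nvm_W pi Gamma = fun xi => magnetization xi
    / Num.sqrt (mean mass (fun eta => magnetization eta ^+ 2)).
Proof.
move=> piE m0; set n : R := #|V|%:R.
have n0 : 0 < n by rewrite ltr0n.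
have SE xi : nvm_S pi xi = (2 * n)^-1 * magnetization xi + 2^-1.
  have -> : 2^-1 = \sum_(x : V) (2 * n)^-1 :> R.
    rewrite sumr_const cardT -cardE -[RHS]mulr_natl -/n; field.
    by rewrite gt_eqF.
  rewrite /nvm_S /magnetization mulr_sumr -big_split/=; apply: eq_bigr => x _.
  by rewrite piE -/n /spin; case: (xi x) => /=; field; rewrite gt_eqF.
have ES : fine ('E_Gamma[nvm_S pi])%E = 2^-1.
  rewrite expectation_config /= (eq_mean _ SE) meanD meanZ m0 mulr0 add0r.
  exact: mean_cst.
have sd : nvm_sigma pi Gamma = (2 * n)^-1 *
    Num.sqrt (mean mass (fun eta => magnetization eta ^+ 2)).
  rewrite /nvm_sigma variance_config /=.
  have -> : var mass (nvm_S pi) = (2 * n)^-1 ^+ 2 *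
      mean mass (fun eta => magnetization eta ^+ 2).
    rewrite -meanZ; apply: eq_mean => xi.
    have -> : mean mass (nvm_S pi) = 2^-1.
      by move: ES; rewrite expectation_config.
    by rewrite SE addrK exprMn.
  rewrite sqrtrM ?sqr_ge0// sqrtr_sqr ger0_norm// invr_ge0 mulr_ge0// ltW//.
apply/funext => xi; rewrite /nvm_W ES SE addrK sd -mulf_div divff ?mul1r//.
by rewrite invr_eq0 mulf_neq0// ?pnatr_eq0// gt_eqF.
Qed.

End FiniteExpectation.

(** * The central limit theorem *)

Theorem corollary5 (R : realType)
    (V : nat -> finType)
    (e : forall n : nat, rel (V n))
    (pi : forall n : nat, V n -> R)
    (p : nat -> R)
    (Gamma : forall n : nat, probability (config (V n)) R)
    (cardV : forall n : nat, (1 < n)%N -> #|V n| = n)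
    (simple_e : forall n : nat, (1 < n)%N -> simple_graph (e n))
    (connected_e : forall n : nat, (1 < n)%N -> connected_graph (e n))
    (regular_e : forall n : nat, (1 < n)%N -> regular_graph (e n))
    (stationary_pi : forall n : nat, (1 < n)%N ->
       stationary (rw_matrix R (e n)) (pi n))
    (p_gt0 : forall n : nat, (1 < n)%N -> 0 < p n)
    (p_le1 : forall n : nat, (1 < n)%N -> p n <= 1)
    (p_nonincreasing : forall m n : nat, (1 < m)%N -> (m <= n)%N -> p n <= p m)
    (stationary_Gamma : forall n : nat, (1 < n)%N ->
       nvm_stationary (rw_matrix R (e n)) (p n) (Gamma n))
    (p_large : p n * Num.sqrt (n%:R : R) @[n --> \oo] --> +oo) :
  @cvg_in_distribution R _ (fun n : nat => config (V n)) Gamma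
    (fun n : nat => nvm_W (pi n) (Gamma n)) (normal_prob 0 1).
Proof.
move=> t _.
rewrite -[X in _ --> X]fineK ?fin_num_measure// -[fine _]/(gauss_cdf t).
under eq_fun do rewrite cdf_config.
apply/cvg_EFin; first exact: nearW.
apply: (stein_cdf_cvg
  (W := fun n => nvm_W (pi n) (Gamma n) : config (V n) -> R)
  (d := fun n => 4 / (p n * Num.sqrt n%:R))).
- near=> n.
  have n1 : (1 < n)%N by near: n; exists 2.
  have Vn := cardV n n1; have V1 : (1 < #|V n|)%N by rewrite Vn.
  have V0 : (0 < #|V n|)%N by exact: ltnW.
  have [s r] := (simple_e n n1, regular_e n n1); have c := connected_e n n1.
  have [G0 G1 GK] := stationary_Gamma n n1.
  have sG : stationary (nvm (rw_matrix R (e n)) (p n)) (mass (Gamma n)).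
    by split.
  have P0 := @rw_matrix_ge0 R _ (e n).
  have Prow := @rw_matrix_row R _ _ c V1.
  have Pcol := @rw_matrix_col R _ _ s c r V1.
  have Pdiag := @rw_matrix_diag R _ _ s.
  have pin := @stationary_uniform R _ _ s c r V1 _ (stationary_pi n n1).
  split=> //; rewrite (nvm_W_magnetization G1 V0 pin); last first.
    exact: (nvm_magnetization_mean0 Prow Pcol (p_gt0 n n1) V0 sG).
  have := nvm_stein_discrepancy P0 Prow Pcol Pdiag (p_gt0 n n1)
    (p_le1 n n1) V0 sG.
  by rewrite Vn; apply.
- rewrite -(mulr0 4); apply: cvgMl_tmp.
  apply/gtr0_cvgV0 => //; near=> n.
  by rewrite mulr_gt0 ?sqrtr_gt0 ?ltr0n ?p_gt0//; near: n; [exists 2|exists 1].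
Unshelve. all: by end_near. Qed.
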